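(* Let $0<\alpha<1$, $p=\frac1\alpha$, and let $\omega:\mathbb{Z}\to(0,\infty)$ be a discrete weight. Then $\omega\in\mathcal{A}(p,\infty)$ if and only if there exists a constant $C>0$ such that for every symmetric interval $S_{m,N}\subset\mathbb{Z}$ ($m\in\mathbb{Z}$, $N\in\mathbb{N}$) and every real sequence $x=\{x(k)\}_{k\in\mathbb{Z}}$ for which the series defining $I_\alpha x(k)$ converges absolutely for all $k\in\mathbb{Z}$, $$\Bigg(\sup_{k\in S_{m,N}}\omega(k)\Bigg)\frac{1}{|S_{m,N}|}\sum_{k\in S_{m,N}}\big|I_\alpha x(k)-(I_\alpha x)_{S_{m,N}}\big|\le C\Bigg(\sum_{k\in\mathbb{Z}}|x(k)\omega(k)|^p\Bigg)^{1/p},$$ where $(I_\alpha x)_{S_{m,N}}:=\frac1{|S_{m,N}|}\sum_{k\in S_{m,N}}I_\alpha x(k)$.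
   Context: For $m\in\mathbb{Z}$ and $N\in\mathbb{N}=\{0,1,2,\dots\}$, let $S_{m,N}:=\{k\in\mathbb{Z}:|k-m|\le N\}$, with cardinality $|S_{m,N}|=2N+1$. A discrete weight is a function $\omega:\mathbb{Z}\to(0,\infty)$. Weight class: with $p'$ the conjugate exponent ($\frac1p+\frac1{p'}=1$), $\omega\in\mathcal{A}(p,\infty)$ means $$\sup_{m\in\mathbb{Z},\,N\in\mathbb{N}}\Bigg(\sup_{k\in S_{m,N}}\omega(k)\Bigg)\Bigg(\frac1{|S_{m,N}|}\sum_{k\in S_{m,N}}\omega(k)^{-p'}\Bigg)^{1/p'}<\infty.$$ Operator: the discrete Riesz potential of a real sequence $x$ is $I_\alpha x(k):=\sum_{i\in\mathbb{Z}\setminus\{k\}}\frac{x(i)}{|k-i|^{1-\alpha}}$, $k\in\mathbb{Z}$. The right-hand side of the inequality may be $+\infty$, in which case the inequality holds trivially. *)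

(* Defs.v *)
From HB Require Import structures.
From mathcomp Require Import all_boot all_order all_algebra.
From mathcomp Require Import all_classical all_reals all_analysis.

Set Implicit Arguments.
Unset Strict Implicit.
Unset Printing Implicit Defensive.

Import Order.TTheory GRing.Theory Num.Theory.

Local Open Scope classical_set_scope.
Local Open Scope ring_scope.

Definition sym_interval (m : int) (N : nat) : set int :=
  [set k : int | `|k - m| <= N%:Z].

(* [sym_interval m N] has N.*2.+1 elements *)
Definition average (R : realType) (f : int -> R) (m : int) (N : nat) : R :=
  (N.*2.+1)%:R^-1 * \sum_(k \in sym_interval m N) f k.

Definition conj_exponent (R : realType) (p : R) : R :=
  fine (hoelder_conjugate p%:E).

Definition weight_class (R : realType) (p : R) (omega : int -> R) : Prop :=
  let p' := conj_exponent p in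
  (ereal_sup (range (fun mN : int * nat =>
    (sup (omega @` sym_interval mN.1 mN.2) *
     average (fun k => omega k `^ (- p')) mN.1 mN.2 `^ (p'^-1))%:E))
   < +oo)%E.

Definition riesz_term (R : realType) (alpha : R) (x : int -> R) (k i : int) : R :=
  x i / (`|k - i|%:~R `^ (1 - alpha)).

Definition riesz_abs_cvg (R : realType) (alpha : R) (x : int -> R) (k : int) :
    Prop :=
  summable (~` [set k]) (EFin \o riesz_term alpha x k).

(* [\esum] is meant for nonnegative terms, so the sum of an absolutely
   convergent series is the difference of the sums of its positive and
   negative parts; the value is meaningful only under [riesz_abs_cvg]. *)
Definition riesz_potential (R : realType) (alpha : R) (x : int -> R) (k : int) :
    R :=
  fine (\esum_(i in ~` [set k]) (EFin \o riesz_term alpha x k)^\+%E i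
        - \esum_(i in ~` [set k]) (EFin \o riesz_term alpha x k)^\-%E i)%E.

(* extended-real valued: +oo when x * omega is not p-summable *)
Definition weighted_lp_norm (R : realType) (p : R) (omega x : int -> R) :
    \bar R :=
  ((\esum_(k in [set: int]) (`|x k * omega k| `^ p)%:E) `^ (p^-1))%E.

(* Main.v *)
(** Put v = w^(-p') and n = 2N+1, where 1/p' = 1 - alpha.  By Hoelder, the weight
    condition on S_{m,M} gives
      sum_{S_{m,M}} |x| <= D (2M+1)^(1-alpha)  for all M >= N,
    with D = K ||x w||_p / sup_{S_{m,N}} w.  This alone bounds the oscillation
    of I_alpha x on S_{m,N} by a multiple of D: the indices within n of m are
    controlled by sum_{0<|d|<=L} |d|^(alpha-1) <= (2/alpha) L^alpha, and for the
    others the kernel difference is O(N |i-m|^(alpha-2)), whose dyadic annuli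
    sum to a geometric series.  The estimate is proved for truncations of the
    potential and passes to the limit.

    Conversely, test the inequality on x = v restricted to S_{m,N}, over the
    interval S_{m,5n}: I_alpha x exceeds its translate by 3n by at least
    (2^(alpha-1) - 3^(alpha-1)) n^(alpha-1) sum_{S_{m,N}} v at n points. *)

Require Import Defs.
From HB Require Import structures.
From mathcomp Require Import all_boot all_order all_algebra.
From mathcomp Require Import all_classical all_reals all_analysis.
From mathcomp Require Import zify ring lra.

Set Implicit Arguments.
Unset Strict Implicit.
Unset Printing Implicit Defensive.

Import Order.TTheory GRing.Theory Num.Theory.
Import numFieldNormedType.Exports.

Local Open Scope classical_set_scope.
Local Open Scope ring_scope.

(** * Symmetric intervals as lists *)

(** With a duplicate-free list, sums over intervals become list big operators and inclusions between
    intervals reduce to linear integer arithmetic. *)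
Definition interval_seq (m : int) (N : nat) : seq int :=
  [seq m - N%:Z + j%:Z | j <- iota 0 N.*2.+1].

Lemma mem_interval_seq (m : int) (N : nat) (k : int) :
  (k \in interval_seq m N) = (`|k - m| <= N%:Z).
Proof.
apply/mapP/idP => [[j]|kmN].
  by rewrite mem_iota => /andP[_ j_lt] ->; lia.
by exists (absz (k - m + N%:Z)); [rewrite mem_iota; lia | lia].
Qed.

Lemma interval_seq_uniq (m : int) (N : nat) : uniq (interval_seq m N).
Proof.
rewrite map_inj_uniq ?iota_uniq// => i j; lia.
Qed.

Lemma size_interval_seq (m : int) (N : nat) : size (interval_seq m N) = N.*2.+1.
Proof. by rewrite size_map size_iota. Qed.

Lemma sym_intervalE (m : int) (N : nat) :
  sym_interval m N = [set` interval_seq m N].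
Proof. by apply/seteqP; split=> k /=; rewrite mem_interval_seq. Qed.

Lemma averageE (R : realType) (f : int -> R) (m : int) (N : nat) :
  average f m N = (N.*2.+1)%:R^-1 * \sum_(k <- interval_seq m N) f k.
Proof.
by rewrite /average sym_intervalE -fsbig_seq// interval_seq_uniq.
Qed.

(** Used after [bigID] to identify the central part of a sum over a larger interval. *)
Lemma sum_interval_seq_widen (V : nmodType) (f : int -> V) (m : int)
    (M M' : nat) : (M <= M')%N ->
  \sum_(i <- interval_seq m M' | `|i - m| <= M%:Z) f i =
  \sum_(i <- interval_seq m M) f i.
Proof.
move=> MM'; rewrite -big_filter; apply: perm_big; apply: uniq_perm.
- by rewrite filter_uniq// interval_seq_uniq.
- exact: interval_seq_uniq.
- by move=> i; rewrite mem_filter !mem_interval_seq; lia.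
Qed.

Lemma ler_sum_uniq_subset (R : numDomainType) (I : eqType) (s t : seq I)
    (f : I -> R) : uniq s -> uniq t -> {subset s <= t} ->
  (forall i, 0 <= f i) -> \sum_(i <- s) f i <= \sum_(i <- t) f i.
Proof.
move=> us ut st f0; rewrite [leRHS](bigID (mem s))/=.
rewrite -[X in _ <= X + _]big_filter.
have -> : \sum_(i <- [seq i <- t | i \in s]) f i = \sum_(i <- s) f i.
  apply: perm_big; apply: uniq_perm => //; first exact: filter_uniq.
  by move=> i; rewrite mem_filter; case: (boolP (i \in s)) => // /st ->.
by rewrite lerDl sumr_ge0.
Qed.

(** * Size and regularity of the Riesz kernel *)

(* [riesz_kernel a 0 = 0], since [0 `^ (1 - a)] and [0^-1] are [0]: sums of
   [x i * riesz_kernel a (k - i)] need not exclude [i = k]. *)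
Definition riesz_kernel (R : realType) (a : R) (d : int) : R :=
  (`|d|%:~R `^ (1 - a))^-1.

Lemma riesz_kernel_ge0 (R : realType) (a : R) (d : int) :
  0 <= riesz_kernel a d.
Proof. by rewrite invr_ge0 powR_ge0. Qed.

Lemma powR_mul_compl (R : realType) (a x : R) :
  0 < x -> x `^ a * x `^ (1 - a) = x.
Proof.
move=> x0; rewrite -powRD; last by apply/implyP => _; rewrite gt_eqF.
by rewrite addrC subrK powRr1// ltW.
Qed.

(* Young's inequality with exponents [1 / a] and [1 / (1 - a)] gives
   [n ^ a * (n + 1) ^ (1 - a) <= n + 1 - a]. *)
Lemma riesz_kernel_le_subr (R : realType) (a : R) (n : nat) :
  0 < a -> a < 1 ->
  riesz_kernel a n.+1%:Z <= a^-1 * (n.+1%:R `^ a - n%:R `^ a).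
Proof.
move=> a0 a1; rewrite /riesz_kernel ger0_norm//.
change ((n.+1%:Z)%:~R : R) with (n.+1%:R : R).
have n0 : (0 : R) < n.+1%:R by [].
have h1 : (n%:R : R) `^ a * n.+1%:R `^ (1 - a) <= n.+1%:R - a.
  have b0 : 0 < 1 - a by lra.
  have := @conjugate_powR R (n%:R `^ a) (n.+1%:R `^ (1 - a)) a^-1 (1 - a)^-1
     (powR_ge0 _ _) (powR_ge0 _ _).
  rewrite !invrK !invr_gt0 -!powRrM !mulfV ?gt_eqF// !powRr1//.
  have -> : n.+1%:R = n%:R + 1 :> R by rewrite -natr1.
  by move=> h; apply: (le_trans (h _ _ _)) => //; lra.
rewrite -[X in X <= _]mul1r ler_pdivrMr ?powR_gt0//.
have h2 : (n.+1%:R : R) `^ a * n.+1%:R `^ (1 - a) = n.+1%:R.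
  exact: powR_mul_compl.
by rewrite -mulrA mulrC ler_pdivlMr// mul1r mulrBl h2; lra.
Qed.

(** The bound of [riesz_kernel_le_subr] telescopes; the factor 2 accounts for [d] and [- d], and the
    term at 0 vanishes. *)
Lemma sum_riesz_kernel_le (R : realType) (a : R) (n : nat) :
  0 < a -> a < 1 ->
  \sum_(d <- interval_seq 0 n) riesz_kernel a d <= 2 / a * n%:R `^ a.
Proof.
move=> a0 a1; have k0 : riesz_kernel a 0 = 0.
  by rewrite /riesz_kernel normr0 powR0 ?invr0// gt_eqF// subr_gt0.
elim: n => [|n IHn].
  by rewrite /interval_seq /= big_seq1 /= subr0 addr0 k0 powR0 ?mulr0 ?gt_eqF.
have p : perm_eq (interval_seq 0 n.+1)
    [:: n.+1%:Z, - n.+1%:Z & interval_seq 0 n].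
  move: (interval_seq_uniq 0 n.+1) (interval_seq_uniq 0 n).
  move: (mem_interval_seq 0 n.+1) (mem_interval_seq 0 n).
  move: (interval_seq 0 n.+1) (interval_seq 0 n) => s t ms mt us ut.
  apply: uniq_perm => //.
    by rewrite 2!cons_uniq in_cons !mt ut; lia.
  by move=> i; rewrite 2!in_cons ms mt; lia.
rewrite (perm_big _ p) 2!big_cons.
have -> : riesz_kernel a (- n.+1%:Z) = riesz_kernel a n.+1%:Z.
  by rewrite /riesz_kernel normrN.
have := riesz_kernel_le_subr n a0 a1.
set t := a^-1 * _ => kt.
have -> : 2 / a * n.+1%:R `^ a = t + t + 2 / a * n%:R `^ a :> R.
  by rewrite /t; ring.
by rewrite -!addrA; apply: lerD => //; apply: lerD.
Qed.

(** Translation by [i] carries the interval into the one of radius [N + n] about 0, and the kernel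
    is nonnegative. *)
Lemma sum_riesz_kernel_shift_le (R : realType) (a : R) (m i : int) (N n : nat) :
  0 < a -> a < 1 -> `|i - m| <= n%:Z ->
  \sum_(k <- interval_seq m N) riesz_kernel a (k - i) <=
  2 / a * (N + n)%:R `^ a.
Proof.
move=> a0 a1 imn; apply: (le_trans _ (sum_riesz_kernel_le (N + n) a0 a1)).
rewrite -(big_map (fun k => k - i) xpredT (riesz_kernel a)).
apply: ler_sum_uniq_subset.
- rewrite map_inj_uniq ?interval_seq_uniq// => u v; lia.
- exact: interval_seq_uniq.
- move=> d /mapP[k]; rewrite !mem_interval_seq => + ->; lia.
- exact: riesz_kernel_ge0.
Qed.

(** Stands in for the mean value theorem: with t = x/y in (0,1], the left side is x^(-b) (1 - t^b),
    and t^b >= t because b < 1. *)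
Lemma powRN_sub_le (R : realType) (b x y : R) :
  0 < b -> b < 1 -> 0 < x -> x <= y ->
  x `^ (- b) - y `^ (- b) <= (y - x) / y * x `^ (- b).
Proof.
move=> b0 b1 x0 xy; have y0 : 0 < y by lra.
have h : x / y <= (x / y) `^ b.
  by rewrite ger1_powR// ?divr_gt0//= ?ler_pdivrMr ?mul1r// ltW.
have -> : y `^ (- b) = x `^ (- b) * (x / y) `^ b.
  rewrite powRM ?invr_ge0 ?ltW// mulrA -powRD; last first.
    by apply/implyP => _; rewrite gt_eqF.
  by rewrite addNr powRr0 mul1r -powR_inv1 ?ltW// -powRrM mulN1r.
have -> : (y - x) / y = 1 - x / y by field; lra.
have := powR_ge0 x (- b) => ?; nra.
Qed.

(** Apply [powRN_sub_le] to |d| and |e| in increasing order. If |e| is the smaller, its power must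
    be replaced by that of |d|, which costs the factor 2. *)
Lemma riesz_kernel_sub_le (R : realType) (a : R) (N : nat) (d e : int) :
  0 < a -> a < 1 -> (N.*2.+1%:Z < `|d|) -> `|e - d| <= N%:Z ->
  `|riesz_kernel a e - riesz_kernel a d| <=
  2 * N%:R / `|d|%:~R * `|d|%:~R `^ (a - 1).
Proof.
move=> a0 a1 Nd eN.
have rk c : riesz_kernel a c = `|c|%:~R `^ (- (1 - a)).
  by rewrite /riesz_kernel powRN.
have D0 : (0 : R) < `|d|%:~R by rewrite ltr0z; lia.
have E0 : (0 : R) < `|e|%:~R by rewrite ltr0z; lia.
have b0 : 0 < 1 - a by lra.
have b1 : 1 - a < 1 by lra.
(* Since |d| > 2N+1 and |e - d| <= N, |d| <= 2|e|; moreover 2^(1-a) <= 2. *)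
have h2 : (`|e|%:~R : R) `^ (- (1 - a)) <= 2 * `|d|%:~R `^ (- (1 - a)).
  have h : (`|d|%:~R : R) `^ (1 - a) <= 2 * `|e|%:~R `^ (1 - a).
    apply: (@le_trans _ _ ((2 * `|e|%:~R) `^ (1 - a))).
      rewrite ge0_ler_powR ?nnegrE//; try lra.
      by change (2 : R) with ((2%:Z)%:~R : R); rewrite -intrM ler_int; lia.
    rewrite powRM ?(ltW E0)//.
    by apply: ler_wpM2r; [exact: powR_ge0|apply: ler1_powR; rewrite ?ler1n//; lra].
  rewrite !powRN -[X in X <= _]mul1r ler_pdivrMr ?powR_gt0//.
  rewrite mulrAC ler_pdivlMr ?powR_gt0// mul1r//.
have NeD : `|(`|e|%:~R : R) - `|d|%:~R| <= N%:R.
  by rewrite -rmorphB/= -intr_norm (ler_int R _ N%:Z); lia.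
have -> : a - 1 = - (1 - a) by ring.
rewrite !rk; move: D0 E0 h2 NeD; move: (`|d|%:~R : R) (`|e|%:~R : R) => D E.
move=> D0 E0 h2 NeD.
have pD := powR_gt0 (- (1 - a)) D0; have pE := powR_gt0 (- (1 - a)) E0.
have [DE|ED] := leP D E.
  have h := powRN_sub_le b0 b1 D0 DE.
  have h' : E `^ (- (1 - a)) <= D `^ (- (1 - a)).
    by rewrite !powRN lef_pV2 ?posrE ?powR_gt0// ge0_ler_powR ?nnegrE; lra.
  rewrite distrC ger0_norm ?subr_ge0//.
  apply: (le_trans h); apply: ler_wpM2r; first exact: ltW.
  have hED : E - D <= N%:R by have := ler_norm (E - D); lra.
  have : E^-1 <= D^-1 by rewrite lef_pV2.
  have : 0 < E^-1 by rewrite invr_gt0.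
  move: (E^-1) (D^-1) => E1 D1 E10 ED1; have : 0 <= (N%:R : R) by []; nra.
have h := powRN_sub_le b0 b1 E0 (ltW ED).
have h' : D `^ (- (1 - a)) <= E `^ (- (1 - a)).
  by rewrite !powRN lef_pV2 ?posrE ?powR_gt0// ge0_ler_powR ?nnegrE; lra.
rewrite ger0_norm; last lra.
apply: (le_trans h).
have hED : D - E <= N%:R by have := ler_norm (- (E - D)); rewrite normrN; lra.
have -> : 2 * N%:R / D * D `^ (- (1 - a)) = N%:R / D * (2 * D `^ (- (1 - a))).
  by ring.
apply: ler_pM => //; first by rewrite divr_ge0//; lra.
- exact: ltW.
- by rewrite ler_wpM2r ?invr_ge0//; lra.
Qed.

(* Otherwise unification unfolds the sequence to its first element, and
   [big_cons] and [in_cons] apply to it. *)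
#[global] Opaque interval_seq.

(** * Oscillation of truncated potentials *)

(** Induction on [J]: each doubling of the radius adds one annulus, worth at most 5D/(2^J n). The
    factor 1 - 2^(-J) is the exact partial sum of this geometric series. *)
Lemma sum_dyadic_tail_le (R : realType) (a D : R) (y : int -> R) (m : int)
    (n J : nat) :
  0 < a -> a < 1 -> 0 <= D -> (0 < n)%N -> (forall i, 0 <= y i) ->
  (forall M, (n <= M)%N ->
    \sum_(i <- interval_seq m M) y i <= D * M.*2.+1%:R `^ (1 - a)) ->
  \sum_(i <- interval_seq m (2 ^ J * n) | n%:Z < `|i - m|)
    y i * (`|i - m|%:~R `^ (a - 1) / `|i - m|%:~R) <=
  10 * D / n%:R * (1 - (2 ^+ J)^-1).
Proof.
move=> a0 a1 D0 n0 y0 yD.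
pose w i := y i * (`|i - m|%:~R `^ (a - 1) / `|i - m|%:~R).
under eq_bigr do rewrite -/(w _).
have w0 i : 0 <= w i.
  by rewrite /w mulr_ge0// divr_ge0// ?powR_ge0// ler0z.
elim: J => [|J IHJ].
  rewrite expn0 mul1n expr0 invr1 subrr mulr0 big_seq_cond big1// => i.
  by rewrite mem_interval_seq; lia.
have X0 : (0 : R) < (2 ^ J * n)%:R by rewrite ltr0n muln_gt0 expn_gt0.
(* With X = 2^J n, the factor of [y i] is at most X^(a-1)/X on the annulus, while the sum of [y] is
   at most D (4X+1)^(1-a) <= 5 D X^(1-a). *)
have annulus : \sum_(i <- interval_seq m (2 ^ J.+1 * n) |
    (2 ^ J * n)%:Z < `|i - m|) w i <= 5 * D / (2 ^ J * n)%:R.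
  set X := (2 ^ J * n)%:R.
  apply: (@le_trans _ _ (\sum_(i <- interval_seq m (2 ^ J.+1 * n))
      y i * (X `^ (a - 1) / X))).
    rewrite [leRHS](bigID (fun i => (2 ^ J * n)%:Z < `|i - m|))/=.
    rewrite -[leLHS]addr0 lerD//; last first.
      rewrite sumr_ge0// => i _.
      by rewrite mulr_ge0// divr_ge0 ?powR_ge0 ?(ltW X0).
    apply: ler_sum => i Xi; apply: ler_wpM2l => //.
    have Xi' : X <= `|i - m|%:~R.
      by rewrite /X (ler_int R (2 ^ J * n)%:Z); lia.
    have I0 : 0 < `|i - m|%:~R :> R by apply: lt_le_trans Xi'.
    apply: ler_pM; rewrite ?powR_ge0 ?invr_ge0 ?(ltW I0)//; last first.
      by rewrite lef_pV2.
    rewrite -(opprB 1 a) !powRN lef_pV2 ?posrE ?powR_gt0//.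
    by rewrite ge0_ler_powR ?nnegrE ?subr_ge0 ?(ltW X0) ?(ltW I0) ?(ltW a1).
  rewrite -mulr_suml.
  have M1 : (n <= 2 ^ J.+1 * n)%N.
    by rewrite -{1}(mul1n n) leq_mul2r expn_gt0 orbT.
  have h5 : (2 ^ J.+1 * n).*2.+1%:R `^ (1 - a) <= 5 * X `^ (1 - a).
    apply: (@le_trans _ _ ((5 * X) `^ (1 - a))).
      rewrite ge0_ler_powR ?nnegrE ?subr_ge0 ?(ltW a1)// ?mulr_ge0 ?(ltW X0)//.
      rewrite /X -natrM ler_nat expnS -!mulnA; lia.
    rewrite powRM// ?(ltW X0)// ler_wpM2r ?powR_ge0// ler1_powR ?ler1n//; lra.
  have XX : X `^ (1 - a) * X `^ (a - 1) = 1.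
    rewrite -powRD; last by apply/implyP => _; rewrite gt_eqF.
    by rewrite addrA subrK subrr powRr0.
  have XV : 0 <= X `^ (a - 1) / X by rewrite divr_ge0 ?powR_ge0 ?(ltW X0).
  apply: (le_trans (ler_wpM2r XV (yD _ M1))).
  apply: (@le_trans _ _ (D * (5 * X `^ (1 - a)) * (X `^ (a - 1) / X))).
    by rewrite ler_wpM2r// ler_wpM2l.
  rewrite (_ : _ * _ = 5 * D / X * (X `^ (1 - a) * X `^ (a - 1))); last ring.
  by rewrite XX mulr1.
rewrite (bigID (fun i : int => `|i - m| <= (2 ^ J * n)%:Z))/=.
have -> : \sum_(i <- interval_seq m (2 ^ J.+1 * n) |
    (n%:Z < `|i - m|) && (`|i - m| <= (2 ^ J * n)%:Z)) w i =
  \sum_(i <- interval_seq m (2 ^ J * n) | n%:Z < `|i - m|) w i.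
  rewrite big_mkcondl/= sum_interval_seq_widen -?big_mkcond//.
  by rewrite leq_mul2r leq_exp2l// leqnSn orbT.
have -> : \sum_(i <- interval_seq m (2 ^ J.+1 * n) |
    (n%:Z < `|i - m|) && ~~ (`|i - m| <= (2 ^ J * n)%:Z)) w i =
  \sum_(i <- interval_seq m (2 ^ J.+1 * n) | (2 ^ J * n)%:Z < `|i - m|) w i.
  apply: eq_bigl => i; rewrite -ltNge andb_idl//; apply: le_lt_trans.
  by rewrite lez_nat -{1}(mul1n n) leq_mul2r expn_gt0 orbT.
apply: (le_trans (lerD IHJ annulus)).
rewrite natrM natrX exprS.
have q0 : (2 ^+ J : R) != 0 by rewrite expf_eq0 pnatr_eq0 andbF.
have n1 : n%:R != 0 :> R by rewrite pnatr_eq0 -lt0n.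
by rewrite le_eqVlt; apply/orP; left; apply/eqP; field; rewrite q0 n1.
Qed.

(** The mean may be traded for any convenient constant: |f - A| <= |f - c| + |A - c|, and |A - c| is
    itself at most the average of |f - c|. *)
Lemma sum_dist_average_le (R : realType) (f : int -> R) (m : int) (N : nat)
    (c : R) :
  average (fun k => `|f k - average f m N|) m N <=
  2 * average (fun k => `|f k - c|) m N.
Proof.
set A := average f m N.
have n0 : (0 : R) < N.*2.+1%:R by [].
have cA : `|A - c| <= average (fun k => `|f k - c|) m N.
  have -> : A - c = average (fun k => f k - c) m N.
    rewrite /A !averageE sumrB mulrBr; congr (_ - _).
    rewrite big_const_seq count_predT size_interval_seq iter_addr_0.
    by rewrite -[c *+ _]mulr_natl mulKf ?gt_eqF.
  rewrite !averageE normrM ger0_norm ?invr_ge0// ler_wpM2l ?invr_ge0//.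
  exact: ler_norm_sum.
rewrite [leRHS]mulr_natl mulr2n.
apply: (@le_trans _ _ (average (fun k => `|f k - c| + `|A - c|) m N)).
  rewrite !averageE ler_wpM2l ?invr_ge0//; apply: ler_sum => k _.
  by rewrite (distrC A); exact: ler_distD.
rewrite averageE big_split/= mulrDr -averageE lerD2l.
rewrite big_const_seq count_predT size_interval_seq iter_addr_0.
by rewrite -[`|A - c| *+ _]mulr_natl mulKf ?gt_eqF.
Qed.

Lemma truncated_potential_osc_le (R : realType) (a D : R) (x : int -> R)
    (m : int) (N J : nat) :
  0 < a -> a < 1 -> 0 <= D ->
  (forall M, (N <= M)%N ->
    \sum_(i <- interval_seq m M) `|x i| <= D * M.*2.+1%:R `^ (1 - a)) ->
  let F k := \sum_(i <- interval_seq m (2 ^ J * N.*2.+1))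
    x i * riesz_kernel a (k - i) in
  average (fun k => `|F k - average F m N|) m N <= D * (24 / a + 20).
Proof.
move=> a0 a1 D0 xD; cbv zeta; set n := N.*2.+1.
set F := fun k : int => \sum_(i <- _) _.
have n0 : (0 : R) < n%:R by [].
have nJ : (n <= 2 ^ J * n)%N by rewrite -{1}(mul1n n) leq_mul2r expn_gt0 orbT.
(* The comparison constant is the far part of the potential, frozen at the centre [m]. Thus only far
   indices produce kernel differences; near ones are estimated by absolute values. *)
pose c := \sum_(i <- interval_seq m (2 ^ J * n) | n%:Z < `|i - m|)
  x i * riesz_kernel a (m - i).
pose near k := \sum_(i <- interval_seq m n) `|x i| * riesz_kernel a (k - i).
pose far := \sum_(i <- interval_seq m (2 ^ J * n) | n%:Z < `|i - m|)
  `|x i| * (`|i - m|%:~R `^ (a - 1) / `|i - m|%:~R).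
have Fc k : `|k - m| <= N%:Z -> `|F k - c| <= near k + 2 * N%:R * far.
  move=> km.
  have -> : F k - c =
      \sum_(i <- interval_seq m n) x i * riesz_kernel a (k - i) +
      \sum_(i <- interval_seq m (2 ^ J * n) | n%:Z < `|i - m|)
        x i * (riesz_kernel a (k - i) - riesz_kernel a (m - i)).
    under [X in _ = _ + X]eq_bigr do rewrite mulrBr.
    rewrite sumrB addrA /F (bigID (fun i : int => `|i - m| <= n%:Z))/=.
    rewrite sum_interval_seq_widen//; congr (_ + _ - _).
    by apply: eq_bigl => i; rewrite ltNge.
  apply: (le_trans (ler_normD _ _)); apply: lerD.
    apply: (le_trans (ler_norm_sum _ _ _)); apply: ler_sum => i _.
    by rewrite normrM (ger0_norm (riesz_kernel_ge0 _ _)).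
  apply: (le_trans (ler_norm_sum _ _ _)); rewrite mulr_sumr.
  apply: ler_sum => i ni; rewrite normrM.
  rewrite [leRHS]mulrCA ler_wpM2l// mulrA mulrAC (distrC i).
  apply: riesz_kernel_sub_le => //; last by rewrite opprB addrA subrK.
  by rewrite distrC.
(* Sum over [k] first. Then 12 = 3 * 2 * 2: (2n+1)^(1-a) <= 3 n^(1-a), the kernel sum carries 2/a,
   and (N+n)^a <= 2 n^a. *)
have near_le : \sum_(k <- interval_seq m N) near k <= n%:R * (D * (12 / a)).
  rewrite exchange_big/=.
  apply: (@le_trans _ _ (\sum_(i <- interval_seq m n)
      `|x i| * (2 / a * (N + n)%:R `^ a))).
    rewrite big_seq [leRHS]big_seq; apply: ler_sum => i.
    rewrite mem_interval_seq -mulr_sumr => mi; rewrite ler_wpM2l//.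
    exact: sum_riesz_kernel_shift_le.
  rewrite -mulr_suml.
  have K0 : 0 <= 2 / a * (N + n)%:R `^ a :> R.
    by rewrite mulr_ge0 ?powR_ge0// divr_ge0// ltW.
  have Nn : (N <= n)%N by rewrite /n; lia.
  apply: (le_trans (ler_wpM2r K0 (xD _ Nn))).
  have h1 : n.*2.+1%:R `^ (1 - a) <= 3 * n%:R `^ (1 - a) :> R.
    apply: (@le_trans _ _ ((3 * n%:R) `^ (1 - a))).
      rewrite ge0_ler_powR ?nnegrE ?subr_ge0 ?(ltW a1)//.
      by rewrite -natrM ler_nat; lia.
    rewrite powRM// ler_wpM2r ?powR_ge0// ler1_powR ?ler1n//; lra.
  have h2 : (N + n)%:R `^ a <= 2 * n%:R `^ a :> R.
    apply: (@le_trans _ _ ((2 * n%:R) `^ a)).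
      rewrite ge0_ler_powR ?nnegrE ?(ltW a0)//.
      by rewrite -natrM ler_nat; lia.
    rewrite powRM// ler_wpM2r ?powR_ge0// ler1_powR ?ler1n//; lra.
  have h3 : n%:R `^ (1 - a) * n%:R `^ a = n%:R :> R.
    by rewrite mulrC powR_mul_compl.
  apply: (@le_trans _ _ (D * (3 * n%:R `^ (1 - a)) *
      (2 / a * (2 * n%:R `^ a)))).
    apply: ler_pM => //; first by rewrite mulr_ge0 ?powR_ge0.
      by rewrite ler_wpM2l.
    by rewrite ler_wpM2l// divr_ge0// ltW.
  rewrite -[X in _ <= X * _]h3 le_eqVlt; apply/orP; left; apply/eqP.
  by field; rewrite gt_eqF.
(* The factor 2N is absorbed by 1/n, since n = 2N+1. *)
have far_le : 2 * N%:R * far <= 10 * D.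
  have h : far <= 10 * D / n%:R.
    apply: (@le_trans _ _ (10 * D / n%:R * (1 - (2 ^+ J)^-1))).
      apply: (sum_dyadic_tail_le J a0 a1 D0) => // M nM; apply: xD.
      by apply: leq_trans nM; rewrite /n; lia.
    apply: ler_piMr; first by rewrite divr_ge0// mulr_ge0.
    by rewrite lerBlDr lerDl invr_ge0 exprn_ge0.
  apply: (@le_trans _ _ (n%:R * (10 * D / n%:R))).
    apply: ler_pM => //.
    - by rewrite sumr_ge0// => i _; rewrite mulr_ge0// divr_ge0// ?powR_ge0 ?ler0z.
    - by rewrite -natrM ler_nat /n; lia.
  by rewrite mulrC divfK ?gt_eqF.
apply: (le_trans (sum_dist_average_le _ _ _ c)).
have -> : D * (24 / a + 20) = 2 * (D * (12 / a + 10)).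
  by field; rewrite gt_eqF.
rewrite ler_wpM2l// averageE -/n ler_pdivrMl//.
apply: (@le_trans _ _ (\sum_(k <- interval_seq m N) (near k + 10 * D))).
  rewrite big_seq [leRHS]big_seq; apply: ler_sum => k.
  rewrite mem_interval_seq => /Fc /le_trans; apply; exact: lerD.
rewrite big_split/= big_const_seq count_predT size_interval_seq iter_addr_0.
rewrite -/n -[(_ * D) *+ _]mulr_natl.
rewrite mulrDr mulrDr; apply: lerD => //.
by rewrite [D * 10]mulrC.
Qed.

(** * Finite Hoelder inequality and the weight condition *)

(** Each induction step is the two-term inequality [hoelder2], applied to the head and to the roots
    Su^(1/p), Sv^(1/q) of the tail sums. *)
Lemma hoelder_sum (R : realType) (I : Type) (s : seq I) (u v : I -> R)
    (p q : R) :
  (forall i, 0 <= u i) -> (forall i, 0 <= v i) ->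
  0 < p -> 0 < q -> p^-1 + q^-1 = 1 ->
  \sum_(i <- s) u i * v i <=
  (\sum_(i <- s) u i `^ p) `^ p^-1 * (\sum_(i <- s) v i `^ q) `^ q^-1.
Proof.
move=> u0 v0 p0 q0 pq; elim: s => [|i s IHs].
  by rewrite !big_nil mulr_ge0// powR_ge0.
have S0 (t : I -> R) r : 0 <= \sum_(j <- s) t j `^ r.
  by apply: sumr_ge0 => j _; exact: powR_ge0.
rewrite !big_cons; move: (S0 u p) (S0 v q) IHs.
move: (\sum_(j <- s) _) (\sum_(j <- s) u j `^ p) (\sum_(j <- s) v j `^ q).
move=> Suv Su Sv Su0 Sv0 IHs.
apply: (le_trans (lerD (lexx _) IHs)).
have := hoelder2 (u0 i) (powR_ge0 Su p^-1) (v0 i) (powR_ge0 Sv q^-1) p0 q0 pq.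
by rewrite -(powRrM Su) -(powRrM Sv) !mulVf ?gt_eqF// !powRr1.
Qed.

Lemma conj_exponentE (R : realType) (a : R) :
  0 < a -> a < 1 -> conj_exponent (1 / a) = (1 - a)^-1.
Proof.
move=> a0 a1; rewrite /conj_exponent.
have an0 : a != 0 by rewrite gt_eqF.
have bn0 : 1 - a != 0 by rewrite gt_eqF// subr_gt0.
rewrite -(_ : ((1 - a)^-1)%:E = hoelder_conjugate (1 / a)%:E)//.
apply/hoelder_conjugateP; rewrite ?ltNyr//.
  by rewrite eqe mul1r invr_eq0.
rewrite !inver mul1r !invr_eq0 (negbTE an0) (negbTE bn0) !invrK.
by rewrite -EFinD addrC subrK.
Qed.

Lemma has_ubound_image_sym_interval (R : realType) (w : int -> R) (m : int)
    (N : nat) : has_ubound (w @` sym_interval m N).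
Proof.
exists (\sum_(i <- interval_seq m N) `|w i|) => _ [k km <-].
apply: (le_trans (ler_norm _)); rewrite -(big_seq1 +%R k (fun i => `|w i|)).
apply: ler_sum_uniq_subset => //; first exact: interval_seq_uniq.
by move=> i; rewrite inE => /eqP ->; rewrite mem_interval_seq.
Qed.

(** Lets the weight condition on a large interval be used with the supremum over a smaller
    concentric one. *)
Lemma ler_sup_sym_interval (R : realType) (w : int -> R) (m : int) (N M : nat) :
  (N <= M)%N ->
  sup (w @` sym_interval m N) <= sup (w @` sym_interval m M).
Proof.
move=> NM; apply: sup_le.
- move=> _ [k km <-]; exists (w k); split => //.
  by exists k => //; move: km; rewrite /sym_interval/=; lia.
- by exists (w m), m => //; rewrite /sym_interval/= subrr.
- split; last exact: has_ubound_image_sym_interval.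
  by exists (w m), m => //; rewrite /sym_interval/= subrr.
Qed.

Lemma sup_sym_interval_gt0 (R : realType) (w : int -> R) (m : int) (N : nat) :
  (forall k, 0 < w k) -> 0 < sup (w @` sym_interval m N).
Proof.
move=> w0; apply: (lt_le_trans (w0 m)); apply: ub_le_sup.
  exact: has_ubound_image_sym_interval.
by exists m => //; rewrite /sym_interval/= subrr.
Qed.

(** Replaces the finiteness of an extended supremum by a uniform real bound, with p' = 1/(1-a) made
    explicit. *)
Lemma weight_classE (R : realType) (a : R) (w : int -> R) :
  0 < a -> a < 1 ->
  weight_class (1 / a) w <->
  exists K : R, forall m N, sup (w @` sym_interval m N) *
    average (fun k => w k `^ (- (1 - a)^-1)) m N `^ (1 - a) <= K.
Proof.
move=> a0 a1; rewrite /weight_class conj_exponentE// invrK; split.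
  set E := (X in ereal_sup X) => supE; exists (fine (ereal_sup E)) => m N.
  have Emn : E (sup (w @` sym_interval m N) *
      average (fun k => w k `^ (- (1 - a)^-1)) m N `^ (1 - a))%:E.
    by exists (m, N).
  have := ereal_sup_ubound Emn.
  rewrite -lee_fin fineK// fin_numE -ltey supE andbT.
  (* The supremum is not -oo, as it dominates a real number. *)
  by apply/eqP => ENy; move: (ereal_sup_ubound Emn); rewrite ENy leeNy_eq.
move=> [K wK]; apply: (@le_lt_trans _ _ K%:E); last exact: ltry.
by apply: ge_ereal_sup => _ [[m N] _ <-]; rewrite lee_fin; exact: wK.
Qed.

(** * From truncations to the potential *)

(** [esum] is a supremum over finite sets: some finite [X] comes within [e] of it, and every large
    interval contains [X]. *)
Lemma cvg_sum_interval_seq_esum (R : realType) (f : int -> R) (D : set int)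
    (m : int) :
  (forall i, 0 <= f i) -> (\esum_(i in D) (f i)%:E < +oo)%E ->
  (\sum_(i <- interval_seq m M | i \in D) f i) @[M --> \oo] -->
  fine (\esum_(i in D) (f i)%:E).
Proof.
move=> f0 fD; set s := fine _.
have sE : (\esum_(i in D) (f i)%:E = s%:E)%E.
  rewrite fineK// ge0_fin_numE// esum_ge0// => i _; by rewrite lee_fin.
have ub M : \sum_(i <- interval_seq m M | i \in D) f i <= s.
  rewrite -lee_fin -sE -big_filter -sumEFin; apply: ereal_sup_ubound.
  exists [set` [seq i <- interval_seq m M | i \in D]].
    split; first exact: finite_seq.
    by move=> i /=; rewrite mem_filter => /andP[/set_mem].
  by rewrite -fsbig_seq// filter_uniq// interval_seq_uniq.
apply/cvgrPdist_le => e e0.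
have : ((s - e)%:E < \esum_(i in D) (f i)%:E)%E.
  by rewrite sE lte_fin ltrBlDr ltrDl.
move=> /ereal_sup_gt[_ [X [finX XD] <-]].
rewrite fsbig_finite// sumEFin lte_fin => sX.
(* A crude threshold: the sum of the distances to [m] dominates each of them. *)
exists (\sum_(i <- finmap.enum_fset (fset_set X)) absz (i - m))%N => // M /= XM.
rewrite ger0_norm ?subr_ge0// lerBlDr -lerBlDl; apply: (le_trans (ltW sX)).
rewrite -big_filter; apply: ler_sum_uniq_subset => //.
- by rewrite filter_uniq// interval_seq_uniq.
- move=> i iX; rewrite mem_filter mem_interval_seq.
  rewrite mem_set/=; last by apply: XD; move: iX; rewrite in_fset_set// inE.
  have : (absz (i - m) <= M)%N.
    by apply: leq_trans XM; rewrite (big_rem i)//= leq_addr.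
  by lia.
Qed.

(** Positive and negative parts converge separately, both being dominated by the absolutely
    convergent series. *)
Lemma cvg_riesz_potential (R : realType) (a : R) (x : int -> R) (m k : int) :
  a < 1 -> riesz_abs_cvg a x k ->
  (\sum_(i <- interval_seq m M) x i * riesz_kernel a (k - i)) @[M --> \oo] -->
  riesz_potential a x k.
Proof.
move=> a1; rewrite /riesz_abs_cvg => xk.
set D := ~` [set k]; set f := riesz_term a x k.
have fp : (EFin \o f)^\+%E = (fun i => (Num.max (f i) 0)%:E).
  by apply/funext => i; rewrite funeposE /= EFin_max.
have fn : (EFin \o f)^\-%E = (fun i => (Num.max (- f i) 0)%:E).
  by apply/funext => i; rewrite funenegE /= EFin_max.
have sp : (\esum_(i in D) (Num.max (f i) 0)%:E < +oo)%E.
  apply: le_lt_trans xk; apply: le_esum => i _ /=.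
  by rewrite lee_fin ge_max ler_norm normr_ge0.
have sn : (\esum_(i in D) (Num.max (- f i) 0)%:E < +oo)%E.
  apply: le_lt_trans xk; apply: le_esum => i _ /=.
  by rewrite lee_fin ge_max -normrN ler_norm normr_ge0.
rewrite /riesz_potential -/f -/D fp fn fineB; last 2 first.
- rewrite ge0_fin_numE// esum_ge0// => i _; by rewrite lee_fin le_max lexx orbT.
- rewrite ge0_fin_numE// esum_ge0// => i _; by rewrite lee_fin le_max lexx orbT.
have m0 (g : int -> R) i : 0 <= Num.max (g i) 0 by rewrite le_max lexx orbT.
rewrite (_ : (fun M => _) = (fun M =>
    \sum_(i <- interval_seq m M | i \in D) Num.max (f i) 0 -
    \sum_(i <- interval_seq m M | i \in D) Num.max (- f i) 0)).
  apply: cvgB; apply: cvg_sum_interval_seq_esum => //; exact: m0.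
apply/funext => M; rewrite -sumrB [RHS]big_mkcond; apply: eq_bigr => i _.
have -> : Num.max (f i) 0 - Num.max (- f i) 0 = f i.
  by rewrite /Num.max; do 2 case: ifP; lra.
case: ifPn => // iD.
(* The truncation includes the index [k], excluded from the potential, but its term is 0 because
   [riesz_kernel a 0] is 0. *)
have -> : i = k.
  by move/negP: iD => iD; apply: contrapT => ik; apply: iD; rewrite inE.
rewrite /riesz_kernel subrr normr0 powR0 ?invr0 ?mulr0// gt_eqF// subr_gt0//.
Qed.

Lemma cvg_average (R : realType) (g : nat -> int -> R) (h : int -> R)
    (m : int) (N : nat) :
  (forall k, g M k @[M --> \oo] --> h k) ->
  average (g M) m N @[M --> \oo] --> average h m N.
Proof.
move=> gh; rewrite averageE; under eq_cvg do rewrite averageE.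
apply: cvgM; first exact: cvg_cst.
by apply: cvg_big => [|i _]; [exact: add_continuous | exact: gh].
Qed.

(** The bound for truncations is uniform in [J], and averages over a fixed finite interval pass to
    pointwise limits. *)
Lemma riesz_potential_osc_le (R : realType) (a D : R) (x : int -> R)
    (m : int) (N : nat) :
  0 < a -> a < 1 -> 0 <= D -> (forall k, riesz_abs_cvg a x k) ->
  (forall M, (N <= M)%N ->
    \sum_(i <- interval_seq m M) `|x i| <= D * M.*2.+1%:R `^ (1 - a)) ->
  average (fun k => `|riesz_potential a x k -
    average (riesz_potential a x) m N|) m N <= D * (24 / a + 20).
Proof.
move=> a0 a1 D0 xcvg xD.
pose M J := (2 ^ J * N.*2.+1)%N.
have M_oo : M J @[J --> \oo] --> \oo.
  apply/cvgnyPge => A; exists A => // J /= AJ.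
  by rewrite (leq_trans AJ)// (leq_trans (ltnW (ltn_expl J (ltnSn 1))))// leq_pmulr.
pose F J k := \sum_(i <- interval_seq m (M J)) x i * riesz_kernel a (k - i).
have Fcvg k : F J k @[J --> \oo] --> riesz_potential a x k.
  have h := cvg_riesz_potential m a1 (xcvg k).
  exact: (@cvg_comp _ _ _ M (fun n => \sum_(i <- interval_seq m n)
    x i * riesz_kernel a (k - i)) _ _ _ M_oo h).
apply: (@cvgr_to_le _ \oo _ _
  (fun J => average (fun k => `|F J k - average (F J) m N|) m N)); last first.
  by apply: nearW => J; exact: truncated_potential_osc_le.
apply: cvg_average => k; apply: cvg_norm; apply: cvgB => //.
exact: cvg_average.
Qed.

(** * The weight condition implies the oscillation bound *)

Lemma weighted_lp_norm_ge (R : realType) (p : R) (w x : int -> R)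
    (s : seq int) : 0 < p -> uniq s ->
  (((\sum_(i <- s) `|x i * w i| `^ p) `^ p^-1)%:E <= weighted_lp_norm p w x)%E.
Proof.
move=> p0 us; rewrite /weighted_lp_norm -poweR_EFin.
have s0 : (0 <= (\sum_(i <- s) `|x i * w i| `^ p)%:E)%E.
  by rewrite lee_fin sumr_ge0// => i _; exact: powR_ge0.
have sle : ((\sum_(i <- s) `|x i * w i| `^ p)%:E <=
    \esum_(k in [set: int]) (`|x k * w k| `^ p)%:E)%E.
  apply: esum_ge; exists [set` s]; first by split => //; exact: finite_seq.
  by rewrite -fsbig_seq// sumEFin.
apply: gt0_ler_poweR => //; rewrite ?invr_ge0 ?(ltW p0)// in_itv/= leey andbT//.
exact: le_trans sle.
Qed.

Lemma weight_class_riesz_osc (R : realType) (a : R) (w : int -> R) :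
  0 < a -> a < 1 -> (forall k, 0 < w k) -> weight_class (1 / a) w ->
  exists2 C : R, 0 < C & forall (m : int) (N : nat) (x : int -> R),
    (forall k, riesz_abs_cvg a x k) ->
    ((sup (w @` sym_interval m N) *
      average (fun k => `|riesz_potential a x k -
        average (riesz_potential a x) m N|) m N)%:E <=
      C%:E * weighted_lp_norm (1 / a) w x)%E.
Proof.
move=> a0 a1 w0 /(weight_classE w a0 a1)[K0 wK0].
(* The maximum with 1 makes the final constant positive, which also settles the case of an infinite
   norm. *)
pose K := Num.max K0 1.
have K_gt0 : 0 < K by rewrite lt_max ltr01 orbT.
have wK m N : sup (w @` sym_interval m N) *
    average (fun k => w k `^ (- (1 - a)^-1)) m N `^ (1 - a) <= K.
  by rewrite le_max wK0.
have c0 : 0 < 24 / a + 20 by rewrite addr_gt0// divr_gt0.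
exists (K * (24 / a + 20)) => [|m N x xcvg]; first by rewrite mulr_gt0.
have p0 : 0 < 1 / a by rewrite divr_gt0.
have [normy|normNy] := eqVneq (weighted_lp_norm (1 / a) w x) +oo%E.
  by rewrite normy gt0_muley ?leey// lte_fin mulr_gt0.
have norm_ge0 : (0 <= weighted_lp_norm (1 / a) w x)%E by exact: poweR_ge0.
have : weighted_lp_norm (1 / a) w x \is a fin_num.
  by rewrite ge0_fin_numE// ltey.
move=> /fineK; set B := fine _ => normE.
have B0 : 0 <= B by rewrite fine_ge0.
rewrite -normE -EFinM lee_fin.
set W := sup _; have W0 : 0 < W by exact: sup_sym_interval_gt0.
rewrite mulrC -ler_pdivlMr//.
have -> : K * (24 / a + 20) * B / W = K * B / W * (24 / a + 20) by ring.
apply: riesz_potential_osc_le => //.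
  by rewrite divr_ge0 ?mulr_ge0// ltW.
move=> M NM.
(* Hoelder is applied to |x| = |x w| w^(-1); the second factor is the average in the weight
   condition, up to normalization. *)
have -> : \sum_(i <- interval_seq m M) `|x i| =
    \sum_(i <- interval_seq m M) `|x i * w i| * (w i)^-1.
  apply: eq_bigr => i _.
  by rewrite normrM (gtr0_norm (w0 i)) mulfK// gt_eqF.
have b0 : 0 < 1 - a by rewrite subr_gt0.
have q0 : 0 < (1 - a)^-1 by rewrite invr_gt0.
have pq : (1 / a)^-1 + ((1 - a)^-1)^-1 = 1.
  by rewrite mul1r !invrK addrC subrK.
have wi0 i : 0 <= (w i)^-1 by rewrite invr_ge0 ltW.
apply: (le_trans (hoelder_sum (interval_seq m M)
  (fun i => normr_ge0 (x i * w i)) wi0 p0 q0 pq)).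
have xB : (\sum_(i <- interval_seq m M) `|x i * w i| `^ (1 / a)) `^ (1 / a)^-1
    <= B.
  rewrite -lee_fin normE; apply: weighted_lp_norm_ge => //.
  exact: interval_seq_uniq.
set n := M.*2.+1%:R; set A := average (fun k => w k `^ (- (1 - a)^-1)) m M.
have n0 : 0 < n by rewrite ltr0n.
have A0 : 0 <= A.
  rewrite /A averageE mulr_ge0 ?invr_ge0// sumr_ge0// => i _; exact: powR_ge0.
have -> : \sum_(i <- interval_seq m M) (w i)^-1 `^ (1 - a)^-1 = n * A.
  rewrite /A averageE mulVKf ?gt_eqF//; apply: eq_bigr => i _.
  by rewrite -powR_inv1 ?(ltW (w0 i))// -powRrM mulN1r.
rewrite invrK powRM ?(ltW n0)//.
have AK : A `^ (1 - a) <= K / W.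
  (* The supremum over S_{m,M} is at least [W], so one [D] = K B / W serves all M >= N. *)
  rewrite ler_pdivlMr// mulrC; apply: le_trans (wK m M).
  by rewrite ler_wpM2r ?powR_ge0// ler_sup_sym_interval.
have -> : K * B / W * n `^ (1 - a) = B * (n `^ (1 - a) * (K / W)) by ring.
apply: ler_pM => //; rewrite ?powR_ge0 ?mulr_ge0 ?powR_ge0//.
by rewrite ler_wpM2l ?powR_ge0.
Qed.

(** * The oscillation bound implies the weight condition *)

Lemma riesz_kernel_anti (R : realType) (a : R) (d e : int) :
  a < 1 -> 0 < d -> d <= e -> riesz_kernel a e <= riesz_kernel a d :> R.
Proof.
move=> a1 d0 de.
have D0 : (0 : R) < `|d|%:~R by rewrite ltr0z; lia.
have DE : `|d|%:~R <= `|e|%:~R :> R by rewrite ler_int; lia.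
rewrite /riesz_kernel lef_pV2 ?posrE ?powR_gt0 ?(lt_le_trans D0)//.
by rewrite ge0_ler_powR ?nnegrE ?subr_ge0 ?(ltW a1) ?(le_trans (ltW D0))// ltW.
Qed.

Lemma riesz_kernelM (R : realType) (a : R) (k n : nat) :
  riesz_kernel a (k * n)%:Z = n%:R `^ (a - 1) * k%:R `^ (a - 1) :> R.
Proof.
rewrite /riesz_kernel -powRN opprB ger0_norm//.
by rewrite -pmulrn natrM powRM// mulrC.
Qed.

(** Potentials at [n] points just right of S_{m,N} are compared with those at their translates by
    [L * n]; [A] cancels in the difference. The bound is informative once L > 2. *)
Lemma riesz_osc_ge (R : realType) (a A : R) (y : int -> R) (m : int)
    (N L : nat) :
  a < 1 -> (0 < L)%N -> (forall i, 0 <= y i) ->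
  let n := N.*2.+1 in
  let F k := \sum_(i <- interval_seq m N) y i * riesz_kernel a (k - i) in
  n%:R * ((\sum_(i <- interval_seq m N) y i) *
    (n%:R `^ (a - 1) * (2 `^ (a - 1) - L%:R `^ (a - 1)))) <=
  2 * \sum_(k <- interval_seq m (L.+2 * n)) `|F k - A|.
Proof.
move=> a1 L0 y0; cbv zeta; set n := N.*2.+1.
set F := fun k : int => \sum_(i <- _) _.
set V := \sum_(i <- _) y i.
(* For j < n, [near j] is at distance at most 2n from every point of S_{m,N} and [far j] at distance
   at least L n; both stay within (L+2) n of [m]. *)
pose near j := m + N%:Z + 1 + j%:Z; pose far j := near j + (L * n)%:Z.
have sub (h : nat -> int) : injective h ->
    (forall j, (j < n)%N -> `|h j - m| <= (L.+2 * n)%:Z) ->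
    \sum_(j <- iota 0 n) `|F (h j) - A| <=
    \sum_(k <- interval_seq m (L.+2 * n)) `|F k - A|.
  move=> hinj hM; rewrite -(big_map h xpredT (fun k => `|F k - A|)).
  apply: ler_sum_uniq_subset => //.
  - by rewrite map_inj_uniq// iota_uniq.
  - exact: interval_seq_uniq.
  - move=> k /mapP[j]; rewrite mem_iota => /andP[_ jn] ->.
    by rewrite mem_interval_seq hM.
have FB j : (j < n)%N -> V * (n%:R `^ (a - 1) * (2 `^ (a - 1) -
    L%:R `^ (a - 1))) <= F (near j) - F (far j).
  move=> jn; rewrite /F -sumrB /V mulr_suml big_seq [leRHS]big_seq.
  apply: ler_sum => i; rewrite mem_interval_seq => im.
  rewrite -mulrBr ler_wpM2l// mulrBr -!riesz_kernelM.
  apply: lerB; apply: riesz_kernel_anti => //; rewrite /far /near; nia.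
have -> : n%:R * (V * (n%:R `^ (a - 1) * (2 `^ (a - 1) - L%:R `^ (a - 1)))) =
    \sum_(j <- iota 0 n) V * (n%:R `^ (a - 1) * (2 `^ (a - 1) -
    L%:R `^ (a - 1))).
  by rewrite big_const_seq count_predT size_iota iter_addr_0 mulr_natl.
rewrite [leRHS]mulr_natl [leRHS]mulr2n.
(* The factor 2 arises because near and far points are each bounded by the whole sum. *)
apply: le_trans (lerD (sub near _ _) (sub far _ _)).
- rewrite -big_split big_seq [leRHS]big_seq; apply: ler_sum => j.
  rewrite mem_iota => /andP[_ jn]; apply: (le_trans (FB j jn)).
  have -> : F (near j) - F (far j) = (F (near j) - A) - (F (far j) - A) by ring.
  by rewrite (le_trans (ler_norm _))// ler_normB.
- by move=> i j; rewrite /near; lia.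
- move=> j jn; rewrite /near; nia.
- by move=> i j; rewrite /far /near; lia.
- move=> j jn; rewrite /far /near; nia.
Qed.

Lemma esum_finite_support (R : realType) (s : seq int) (g : int -> R) :
  uniq s -> (forall i, 0 <= g i) -> (forall i, i \notin s -> g i = 0) ->
  (\esum_(i in [set: int]) (g i)%:E)%E = (\sum_(i <- s) g i)%:E.
Proof.
move=> us g0 gs.
rewrite -sumEFin fsbig_seq// -esum_fset; [|exact: finite_seq|]; last first.
  by move=> i _; rewrite lee_fin.
rewrite [RHS]esum_mkcond; apply: eq_esum => i _.
case: ifPn => // /negP si; rewrite gs//; apply/negP => is_s; apply: si.
by rewrite inE.
Qed.

Lemma riesz_abs_cvg_finite_support (R : realType) (a : R) (x : int -> R)
    (s : seq int) (k : int) :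
  uniq s -> (forall i, i \notin s -> x i = 0) -> riesz_abs_cvg a x k.
Proof.
move=> us xs; rewrite /riesz_abs_cvg /summable.
apply: (@le_lt_trans _ _ (\esum_(i in [set: int]) `|riesz_term a x k i|%:E)%E).
  rewrite esum_mkcond; apply: le_esum => i _.
  by case: ifP => // _; rewrite lee_fin.
rewrite (esum_finite_support us) ?ltry// => i si.
by rewrite /riesz_term xs// mul0r normr0.
Qed.

(** The truncations are constant from radius [N] on, so their limit is the finite sum. *)
Lemma riesz_potential_finite_support (R : realType) (a : R) (x : int -> R)
    (m : int) (N : nat) (k : int) :
  a < 1 -> (forall i, i \notin interval_seq m N -> x i = 0) ->
  riesz_potential a x k =
  \sum_(i <- interval_seq m N) x i * riesz_kernel a (k - i).
Proof.
move=> a1 xs.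
have xcvg := riesz_abs_cvg_finite_support a k (interval_seq_uniq m N) xs.
have h := cvg_riesz_potential m a1 xcvg.
apply: (cvg_unique _ h); first exact: Rhausdorff.
apply: cvg_near_cst; exists N => // M /= NM.
rewrite -(sum_interval_seq_widen _ m NM) [RHS]big_mkcond.
apply: eq_bigr => i _; case: ifPn => // im.
by rewrite xs ?mul0r// mem_interval_seq.
Qed.

Lemma riesz_osc_weight_class (R : realType) (a C : R) (w : int -> R) :
  0 < a -> a < 1 -> (forall k, 0 < w k) ->
  (forall (m : int) (N : nat) (x : int -> R),
    (forall k, riesz_abs_cvg a x k) ->
    ((sup (w @` sym_interval m N) *
      average (fun k => `|riesz_potential a x k -
        average (riesz_potential a x) m N|) m N)%:E <=
      C%:E * weighted_lp_norm (1 / a) w x)%E) ->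
  weight_class (1 / a) w.
Proof.
move=> a0 a1 w0 Cosc; apply/(weight_classE w a0 a1).
have b0 : 0 < 1 - a by rewrite subr_gt0.
pose q := (1 - a)^-1; have q0 : 0 < q by rewrite invr_gt0.
(* This is [riesz_osc_ge] with L = 3, the least integer making [c] positive; accordingly M = 5n
   below. *)
pose c : R := 2 `^ (a - 1) - 3 `^ (a - 1).
have c0 : 0 < c.
  rewrite subr_gt0 -(opprB 1 a) !powRN ltf_pV2 ?posrE ?powR_gt0//.
  by rewrite gt0_ltr_powR ?nnegrE// ltr_nat.
(* 22 = 2 * 11: the 2 of [riesz_osc_ge], and 2M+1 = 10n+1 <= 11n. *)
exists (22 * C / c) => m N.
pose n := N.*2.+1; pose M := (5 * n)%N; pose s := interval_seq m N.
have NM : (N <= M)%N by rewrite /M /n; clear; lia.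
have M_leN : (M.*2.+1 <= 11 * n)%N by rewrite /M /n; clear; lia.
have n0 : (0 : R) < n%:R by rewrite ltr0n.
pose v k := w k `^ (- q).
have v0 k : 0 < v k by rewrite powR_gt0.
pose x k := if k \in s then v k else 0.
have xs k : k \notin s -> x k = 0 by rewrite /x => /negbTE ->.
have x0 k : 0 <= x k by rewrite /x; case: ifP => // _; exact: ltW.
have us : uniq s := interval_seq_uniq m N.
have Ix k : riesz_potential a x k =
    \sum_(i <- interval_seq m N) x i * riesz_kernel a (k - i).
  exact: riesz_potential_finite_support.
pose V := \sum_(i <- s) x i.
have VE : V = \sum_(i <- s) v i.
  by rewrite /V big_seq [RHS]big_seq; apply: eq_bigr => i; rewrite /x => ->.
have V0 : 0 < V.
  rewrite VE; apply: (lt_le_trans (v0 m)); rewrite -(big_seq1 +%R m v).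
  apply: ler_sum_uniq_subset => // [i|i]; last exact: ltW.
  by rewrite inE => /eqP ->; rewrite mem_interval_seq subrr.
(* The choice v = w^(-q) gives (v w)^(1/a) = v, because (1-q)/a = -q. *)
have norm_x : weighted_lp_norm (1 / a) w x = (V `^ a)%:E.
  rewrite /weighted_lp_norm (@esum_finite_support _ s)//.
  - rewrite poweR_EFin mul1r invrK VE big_seq [in RHS]big_seq.
    congr ((_ `^ _)%:E); apply: eq_bigr => i is_s.
    rewrite /x is_s ger0_norm ?mulr_ge0 ?(ltW (v0 i)) ?(ltW (w0 i))//.
    rewrite /v -{2}(powRr1 (ltW (w0 i))) -powRD; last first.
      by apply/implyP => _; rewrite gt_eqF.
    rewrite -powRrM; congr (_ `^ _); rewrite /q; field.
    by rewrite !gt_eqF.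
  - by move=> i si; rewrite xs// mul0r normr0 powR0// mul1r invr_eq0 gt_eqF//.
have := Cosc m M x (fun k => riesz_abs_cvg_finite_support a k us xs).
rewrite norm_x -EFinM lee_fin.
set W' := sup _; set A := average (riesz_potential a x) m M => h.
have W'0 : 0 < W' by exact: sup_sym_interval_gt0.
have osc : V * (n%:R `^ (a - 1) * c) / 22 <=
    average (fun k => `|riesz_potential a x k - A|) m M.
  have := @riesz_osc_ge R a A x m N 3 a1 isT x0.
  cbv zeta; under [X in _ <= _ * X]eq_bigr do rewrite -Ix.
  rewrite averageE -/n -/s -/V -/c ler_pdivlMl//.
  set S := \sum_(k <- _) `|_| => h'.
  have M_le : M.*2.+1%:R <= 11 * n%:R :> R.
    by rewrite -natrM ler_nat.
  move: h'; set T := V * _ => h'.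
  have T0 : 0 <= T.
    by rewrite mulr_ge0 ?(ltW V0)// mulr_ge0 ?powR_ge0// ltW.
  have T22 : 0 <= T / 22 by rewrite divr_ge0.
  apply: (le_trans (ler_wpM2r T22 M_le)); lra.
have {h osc} h : W' * (V * (n%:R `^ (a - 1) * c) / 22) <= C * V `^ a.
  by apply: le_trans h; rewrite ler_wpM2l// ltW.
have WW' : sup (w @` sym_interval m N) <= W' by exact: ler_sup_sym_interval.
apply: (le_trans (ler_wpM2r (powR_ge0 _ _) WW')).
have -> : average (fun k => w k `^ (- (1 - a)^-1)) m N = n%:R^-1 * V.
  by rewrite averageE -/n -/s VE.
rewrite powRM ?invr_ge0 ?(ltW n0) ?(ltW V0)//.
have -> : n%:R^-1 `^ (1 - a) = n%:R `^ (a - 1) :> R.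
  by rewrite -powR_inv1 ?(ltW n0)// -powRrM mulN1r opprB.
(* Writing V = V^a V^(1-a) cancels the norm V^a; what remains, n^(a-1) V^(1-a), is the averaged
   factor of the weight condition. *)
rewrite ler_pdivlMr// -(ler_pM2r (powR_gt0 a V0)).
rewrite -{1}(powR_mul_compl a V0) in h; move: h.
move: (V `^ a) (V `^ (1 - a)) (n%:R `^ (a - 1)) => Va Vb nb.
lra.
Qed.

Theorem theorem3p7 (R : realType) (alpha p : R) (omega : int -> R)
    (alpha_gt0 : 0 < alpha) (alpha_lt1 : alpha < 1) (p_def : p = 1 / alpha)
    (omega_gt0 : forall k : int, 0 < omega k) :
  weight_class p omega <->
  exists C : R, 0 < C /\
    forall (m : int) (N : nat) (x : int -> R),
      (forall k : int, riesz_abs_cvg alpha x k) ->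
      let Ix := riesz_potential alpha x in
      ((sup (omega @` sym_interval m N) *
        average (fun k => `|Ix k - average Ix m N|) m N)%:E
       <= C%:E * weighted_lp_norm p omega x)%E.
Proof.
rewrite p_def; split.
  move=> /(weight_class_riesz_osc alpha_gt0 alpha_lt1 omega_gt0)[C C_gt0 oscC].
  by exists C; split.
by move=> [C [_ oscC]]; exact: riesz_osc_weight_class oscC.
Qed.
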